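(* Let $k,t$ be positive integers with $t\le k$. There is $n_0(k,t)$ such that for every $n\ge n_0(k,t)$ and every $t$-intersecting family $\mathcal{F}$ of $k$-multisets of $[n]$, $$|\mathcal{F}|\le\binom{n+k-t-1}{k-t}.$$ Furthermore, equality holds if and only if there is a $t$-multiset $T$ of $[n]$ such that $\mathcal{F}$ is the family of all $k$-multisets of $[n]$ that contain $T$.
   Context: $[n]=\{1,\dots,n\}$. A multiset $F$ of $[n]$ is a sequence $(m(1,F),\dots,m(n,F))$ of non-negative integers; its cardinality is $|F|=\sum_{i=1}^n m(i,F)$, and $F$ is a $k$-multiset if $|F|=k$. The intersection $F\cap G$ is the multiset with multiplicities $\min\{m(i,F),m(i,G)\}$. A multiset $F$ contains $T$ (written $T\subseteq F$) if $m(i,T)\le m(i,F)$ for all $i$. A family (set) $\mathcal{F}$ of multisets is $t$-intersecting if $|F_1\cap F_2|\ge t$ for all $F_1,F_2\in\mathcal{F}$. *)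

(* Defs.v *)
From mathcomp Require Import all_boot.
From mathcomp Require Import finmap multiset.

Set Implicit Arguments.
Unset Strict Implicit.
Unset Printing Implicit Defensive.

Local Open Scope mset_scope.

(* Multisets of [n] are {mset 'I_n}: the ground set is {0, ..., n-1}, and F i is
   the multiplicity m(i, F).  Families are finite sets of multisets, which is no
   restriction for families of k-multisets. *)

Definition mcard (n : nat) (F : {mset 'I_n}) : nat := \sum_(i < n) F i.

Definition kmultiset (n k : nat) (F : {mset 'I_n}) : Prop := mcard F = k.

Definition kfamily (n k : nat) (FF : {fset {mset 'I_n}}) : Prop :=
  forall F, F \in FF -> kmultiset k F.

Definition t_intersecting (n t : nat) (FF : {fset {mset 'I_n}}) : Prop :=
  forall F1 F2, F1 \in FF -> F2 \in FF -> t <= mcard (F1 `&` F2).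

Definition full_kfamily (n k : nat) (T : {mset 'I_n})
    (FF : {fset {mset 'I_n}}) : Prop :=
  forall F, F \in FF <-> kmultiset k F /\ T `<=` F.

(* Main.v *)
Require Import Defs.
From mathcomp Require Import all_boot.
From mathcomp Require Import finmap multiset.

(** If some [t]-multiset [T] lies in every member of [FF], then [FF] is part of
    the star of [T], the family of all [k]-multisets containing [T].  Subtracting
    [T] identifies that star with the [(k - t)]-multisets, so it has
    [binom(n + k - t - 1, k - t)] members ([card_star]), and a subfamily of that
    size is the whole star.

    If there is no such [T], then [FF] is strictly smaller once [n] is large.
    Suppose [FF] is not empty.  Every multiset [S] of cardinality at most [t] has a witness [G] in [FF]
    whose intersection with any member [F] of [FF] is not contained in [S]:
    when [|S| < t] the size of the intersection prevents it, and when
    [|S| = t] it suffices that [G] does not contain [S] ([exists_branching]).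
    So a member of [FF] containing [S] contains [S] enlarged by one of the at
    most [k] elements of [G].  Starting from the empty multiset and branching
    [t + 1] times, [FF] is covered by the members containing one of [k ^ (t + 1)]
    multisets of cardinality [t + 1], hence has at most
    [k ^ (t + 1) * binom(n + k - t - 2, k - t - 1)] members
    ([card_branching]), and none at all when [k = t].  As a function of [n] this has degree one less than the
    size of a star ([ltn_mul_bin]). *)

Local Open Scope mset_scope.

Lemma mcardD n (A B : {mset 'I_n}) : mcard (A `+` B) = mcard A + mcard B.
Proof. by rewrite -big_split; apply: eq_bigr => i _; rewrite msetE2. Qed.

Lemma mcard1 n (i : 'I_n) : mcard [mset i] = 1.
Proof.
rewrite /mcard (bigD1 i) //= msetnxx big1 // => j /negbTE ne_ji.
by rewrite msetnE ne_ji.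
Qed.

Lemma mcardS n (A B : {mset 'I_n}) : A `<=` B -> mcard A <= mcard B.
Proof. by move=> /msubsetP sAB; apply: leq_sum => i _; apply: sAB. Qed.

Lemma msubset_mcard_eq n (A B : {mset 'I_n}) :
  A `<=` B -> mcard B <= mcard A -> A = B.
Proof.
move=> sAB; rewrite -{1}(msetBDKC sAB) mcardD -[leqRHS]addn0 leq_add2l leqn0.
rewrite sum_nat_eq0 => /forallP /= B0; rewrite -(msetBDKC sAB).
apply/msetP => i; rewrite msetE2.
by move/eqP: (B0 i) => ->; rewrite addn0.
Qed.

Lemma size_mset_mcard n (A : {mset 'I_n}) : size A = mcard A.
Proof.
rewrite size_mset /mcard big_uniq ?fset_uniq //=.
rewrite [RHS](bigID (mem (finsupp A))) /= [X in _ = _ + X]big1 ?addn0 // => i.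
by rewrite memNfinsupp => /eqP.
Qed.

Fact mset_of_mults_key : unit. Proof. exact: tt. Qed.
Definition mset_of_mults n d (t : n.-tuple 'I_d.+1) : {mset 'I_n} :=
  [mset[mset_of_mults_key] i in [fset i in enum 'I_n]%fset => val (tnth t i)].

Lemma mset_of_multsE n d (t : n.-tuple 'I_d.+1) i :
  mset_of_mults n d t i = tnth t i.
Proof. by rewrite fsfunE !inE mem_enum. Qed.

(** A multiplicity in a [d]-multiset is at most [d], so the [d]-multisets are
    parametrized by a finite type: the tuples over ['I_d.+1] with sum [d]. *)
Definition msets n d : {fset {mset 'I_n}} :=
  [fset mset_of_mults n d t
     | t in [set t : n.-tuple 'I_d.+1 | \sum_(i <- t) i == d]]%fset.

Lemma mem_msets n d (F : {mset 'I_n}) : (F \in msets n d) = (mcard F == d).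
Proof.
apply/imfsetP/eqP => [[t /= + ->]|cF].
  rewrite inE big_tuple => /eqP {2}<-.
  by apply: eq_bigr => i _; rewrite mset_of_multsE.
have leF i : F i < d.+1 by rewrite ltnS -cF /mcard (bigD1 i) //= leq_addr.
exists [tuple Ordinal (leF i) | i < n] => /=.
  rewrite inE big_tuple; apply/eqP/(etrans _ cF).
  by apply: eq_bigr => i _; rewrite tnth_mktuple.
by apply/msetP => i; rewrite mset_of_multsE tnth_mktuple.
Qed.

Lemma card_msets m d : #|` msets m.+1 d| = 'C(m + d, d).
Proof.
rewrite card_imfset /=; last first.
  move=> t u eq_tu; apply: eq_from_tnth => i; apply: val_inj.
  by rewrite /= -!mset_of_multsE eq_tu.
by rewrite -cardE -bin_sub ?leq_addl // addnK -card_ord_partitions.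
Qed.

Definition star n k (S : {mset 'I_n}) : {fset {mset 'I_n}} :=
  [fset S `+` D | D in msets n (k - mcard S)]%fset.

Lemma starP n k (S F : {mset 'I_n}) : mcard S <= k ->
  reflect (kmultiset k F /\ S `<=` F) (F \in star n k S).
Proof.
move=> leSk; apply: (iffP (imfsetP _ _ _ _)) => [[D /= + ->]|[cF sSF]].
  rewrite mem_msets => /eqP cD; split; first by rewrite /kmultiset mcardD cD subnKC.
  by apply/msubsetP => i; rewrite msetE2 leq_addr.
exists (F `\` S); last by rewrite msetBDKC.
by rewrite mem_msets -cF -{2}(msetBDKC sSF) mcardD addKn.
Qed.

Lemma card_star m k (S : {mset 'I_m.+1}) :
  #|` star m.+1 k S| = 'C(m + (k - mcard S), k - mcard S).
Proof.
rewrite card_imfset /=; last exact: (can_inj (msetDKB S)).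
exact: card_msets.
Qed.

Lemma leq_card_bigfcup (I : Type) (T : choiceType) (r : seq I)
    (A : I -> {fset T}) :
  #|` \bigcup_(i <- r) A i|%fset <= \sum_(i <- r) #|` A i|.
Proof.
elim/big_rec2: _ => [|i a B _ IH]; first by rewrite cardfs0.
by rewrite (leq_trans (leq_card_fsetU _ _)) ?leq_add2l.
Qed.

Definition supersets n (FF : {fset {mset 'I_n}}) (S : {mset 'I_n}) :=
  [fset F : {mset 'I_n} in FF | (S `<=` F)%mset]%fset.

Section Branching.

Variables (n k t : nat) (FF : {fset {mset 'I_n}}).
Hypotheses (FFk : kfamily k FF) (FFt : t_intersecting t FF).
Hypothesis ncore : forall T : {mset 'I_n}, mcard T = t ->
  exists2 G : {mset _}, G \in FF & ~~ (T `<=` G).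

(** [G] is a single witness for all [F]: any element whose multiplicity in
    [F `&` G] exceeds that in [S] can be added to [S] inside [F].  Such an
    element is missing only if [F `&` G `<=` S], which by cardinality forces
    [F `&` G = S] and [|S| = t], and then [G] contains [S].  The member [F0]
    serves as [G] when [|S| < t]. *)
Lemma exists_branching (S F0 : {mset 'I_n}) : F0 \in FF -> mcard S <= t ->
  exists2 G : {mset _}, G \in FF &
    forall F : {mset 'I_n}, F \in FF -> S `<=` F ->
      exists2 i, i \in G & (i +` S) `<=` F.
Proof.
move=> F0FF leSt.
have [G GFF GS] : exists2 G : {mset _}, G \in FF & (mcard S = t -> ~~ (S `<=` G)).
  have [/ncore[G GFF nSG]|neSt] := eqVneq (mcard S) t; first by exists G.
  by exists F0 => // eqSt; rewrite eqSt eqxx in neSt.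
exists G => // F FFF sSF.
have nFGS : ~~ ((F `&` G) `<=` S).
  apply/negP => sFGS; have leFG := FFt _ _ FFF GFF.
  have eqFGS := msubset_mcard_eq _ _ _ sFGS (leq_trans leSt leFG).
  have /negP[] : ~~ (S `<=` G).
    by apply: GS; apply/eqP; rewrite eqn_leq leSt -{1}eqFGS.
  by rewrite -eqFGS msubsetIr.
have [i ltS] : exists i, S i < minn (F i) (G i).
  apply/existsP; apply: contraNT nFGS; rewrite negb_exists => /forallP leS.
  by apply/msubsetP => i; rewrite msetE2 leqNgt.
rewrite leq_min in ltS; case/andP: ltS => ltSF ltSG.
exists i; first by rewrite in_mset (leq_ltn_trans _ ltSG).
apply/msubsetP => j; rewrite mset1DE.
by have [->|_] := eqVneq j i; rewrite ?add1n // add0n (msubsetP sSF).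
Qed.

(** Each branching step costs a factor [k = |G|]; [j] is the number of steps
    left before [S] reaches cardinality [t + 1]. *)
Lemma card_branching N :
    (forall S : {mset 'I_n}, mcard S = t.+1 ->
       #|` supersets _ FF S| <= N) ->
  forall (j : nat) (S : {mset 'I_n}), mcard S + j = t.+1 ->
    #|` supersets _ FF S| <= k ^ j * N.
Proof.
move=> leN; elim=> [|j IHj] S cS; first by rewrite mul1n leN // -cS addn0.
have [FF0|[F0 F0FF]] := fset_0Vmem FF.
  rewrite (_ : supersets _ _ _ = fset0) ?cardfs0 //.
  by apply/fsetP => F; rewrite !inE FF0.
have leSt : mcard S <= t by rewrite -ltnS -cS addnS ltnS leq_addr.
have [G GFF branch] := exists_branching S F0 F0FF leSt.
pose A i := supersets _ FF (i +` S).
have sub : (supersets _ FF S `<=` \bigcup_(i <- G) A i)%fset.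
  apply/fsubsetP => F; rewrite !inE /= => /andP[FFF sSF].
  have [i iG siS] := branch F FFF sSF.
  by apply/bigfcupP; exists i; rewrite ?iG // !inE /= FFF.
apply: leq_trans (fsubset_leq_card sub) _.
apply: leq_trans (leq_card_bigfcup _ _ _ _) _.
apply: (@leq_trans (\sum_(i <- G) k ^ j * N)).
  by apply: leq_sum => i _; apply: IHj; rewrite mcardD mcard1 add1n addSn -addnS.
rewrite big_const_seq iter_addn_0 count_predT size_mset_mcard (FFk _ GFF).
by rewrite expnS mulnC mulnA.
Qed.

End Branching.

(** Since [(d + 1) * binom(m + d + 1, d + 1) = (m + d + 1) * binom(m + d, d)],
    the ratio of the two binomials exceeds [m / (d + 1)]. *)
Lemma ltn_mul_bin M m d : M * d.+1 <= m -> M * 'C(m + d, d) < 'C(m + d.+1, d.+1).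
Proof.
move=> leMm; rewrite -(ltn_pmul2l (ltn0Sn d)) -mul_bin_diag addnS /= mulnA.
rewrite ltn_pmul2r ?bin_gt0 ?leq_addl // mulnC ltnS.
exact: leq_trans leMm (leq_addr _ _).
Qed.

Lemma ltn_card_no_core m k t (FF : {fset {mset 'I_m.+1}}) :
    k ^ t.+2 <= m -> t <= k -> kfamily k FF -> t_intersecting t FF ->
    (forall T : {mset 'I_m.+1}, mcard T = t ->
       exists2 G : {mset _}, G \in FF & ~~ (T `<=` G)) ->
  #|` FF| < 'C(m + (k - t), k - t).
Proof.
move=> le_m le_tk FFk FFt ncore.
(* For [k = t] no [k]-multiset contains a [(t + 1)]-multiset, while the
   truncated binomial would be 1. *)
pose N := if t < k then 'C(m + (k - t.+1), k - t.+1) else 0.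
have leN (S : {mset 'I_m.+1}) : mcard S = t.+1 ->
    #|` supersets _ FF S| <= N.
  rewrite /N => cS; case: ifP => [lt_tk|/negP nlt_tk].
    rewrite -cS -card_star; apply/fsubset_leq_card/fsubsetP => F.
    rewrite !inE /= => /andP[/FFk cF sSF].
    by apply/starP; rewrite ?cS.
  rewrite (_ : supersets _ _ _ = fset0) ?cardfs0 //.
  apply/fsetP => F; rewrite !inE /=; apply/negP => /andP[/FFk cF sSF].
  by apply: nlt_tk; rewrite -cS -cF; apply: mcardS.
have c0 : mcard (mset0 : {mset 'I_m.+1}) = 0.
  by rewrite /mcard big1 // => i _; rewrite mset0E.
have := card_branching _ _ _ FF FFk FFt ncore N leN t.+1 mset0.
rewrite c0 => /(_ erefl).
rewrite (_ : supersets _ _ _ = FF); last first.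
  by apply/fsetP => F; rewrite !inE /= msub0set andbT.
move=> leFF; apply: leq_ltn_trans leFF _; rewrite /N; case: ifP => [lt_tk|_].
  rewrite -(subnSK lt_tk); apply: ltn_mul_bin; apply: leq_trans le_m.
  by rewrite (subnSK lt_tk) [k ^ t.+2]expnSr leq_mul2l leq_subr orbT.
by rewrite muln0 bin_gt0 leq_addl.
Qed.

Theorem corollary1p10 (k t : nat) (k_gt0 : 0 < k) (t_gt0 : 0 < t)
    (le_tk : t <= k) :
  exists n0 : nat, forall n : nat, n0 <= n ->
    forall FF : {fset {mset 'I_n}}, kfamily k FF -> t_intersecting t FF ->
      #|` FF| <= 'C(n + k - t - 1, k - t)
      /\ (#|` FF| = 'C(n + k - t - 1, k - t) <->
          exists T : {mset 'I_n}, kmultiset t T /\ full_kfamily k T FF).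
Proof.
(* The ratio [(m + k - t) / (k - t)] of the star sizes of a [t]- and a
   [(t + 1)]-multiset has to exceed [k ^ (t + 1)]; here [n = m + 1]. *)
exists (k ^ t.+2).+1 => -[//|m] le_m FF FFk FFt.
have -> : m.+1 + k - t - 1 = m + (k - t) by rewrite addSn subnAC subn1 addnBA.
have cstar (T : {mset 'I_m.+1}) : mcard T = t ->
    #|` star m.+1 k T| = 'C(m + (k - t), k - t).
  by move=> cT; rewrite card_star cT.
have full_star (T : {mset 'I_m.+1}) : mcard T = t ->
    full_kfamily k T FF <-> FF = star m.+1 k T.
  move=> cT; have le_cT : mcard T <= k by rewrite cT.
  split=> [FFT|-> F]; last by split=> /(starP _ _ _ _ le_cT).
  by apply/fsetP => F; apply/idP/(starP _ _ _ _ le_cT) => /FFT.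
have [/hasP[T]|/hasPn ncore] :=
    boolP (has (fun T => all (fun F => T `<=` F) (enum_fset FF))
               (enum_fset (msets m.+1 t))).
  rewrite mem_msets => /eqP cT /allP sTF.
  have sub : (FF `<=` star m.+1 k T)%fset.
    apply/fsubsetP => F FFF; apply/starP; first by rewrite cT.
    by split; [apply: FFk | apply: sTF].
  rewrite -(cstar T cT); split; first exact: fsubset_leq_card.
  split=> [eqc|[U [cU /(full_star U cU) ->]]]; last by rewrite !cstar.
  exists T; split=> //; apply/full_star => //.
  by apply/eqP; rewrite eqEfcard sub eqc /=.
have lt_FF : #|` FF| < 'C(m + (k - t), k - t).
  apply: ltn_card_no_core => // T cT.
  have /ncore/allPn[G GFF nTG] : T \in msets m.+1 t by rewrite mem_msets cT.
  by exists G.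
split; first exact: ltnW.
split=> [eqc|[T [cT /(full_star T cT) eqFF]]]; first by rewrite eqc ltnn in lt_FF.
by rewrite eqFF cstar ?ltnn in lt_FF *.
Qed.
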